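(* Let $\Gamma$ be a (finite) simple graph, $\alpha\in H_2(A_\Gamma)$ an arbitrary class, and $M_\alpha$ its connection matrix. Then $M_\alpha$ is also the matrix representation of the cap product map $$\alpha\cap-\colon H^1(A_\Gamma)\to H_1(A_\Gamma)$$ with respect to the basis $V(\Gamma)$ of $H_1(A_\Gamma)$ and the dual basis $\{v^*\}_{v\in V(\Gamma)}$ of $H^1(A_\Gamma)$.
   Context: For a finite simple graph $\Gamma$ with vertex set $V(\Gamma)$ and edge set $E(\Gamma)$, the right angled Artin group (RAAG) is $A_\Gamma=\langle V(\Gamma)\mid st=ts\ \forall \{s,t\}\in E(\Gamma)\rangle$. (Co)homology is integral, and $H_*(A_\Gamma)=H_*(BA_\Gamma)$ for $BA_\Gamma$ a classifying space $K(A_\Gamma,1)$. $H_1(A_\Gamma)$ is free abelian with basis $V(\Gamma)$; let $v^*\in H^1(A_\Gamma)$ be the dual basis. An orientation of $\Gamma$ is a choice, for each edge $\{v,w\}$, of one of the ordered pairs $(v,w)$, $(w,v)$; the set of chosen pairs is $E^{or}(\Gamma)$. Given an orientation, $H_2(A_\Gamma)\cong\mathbb{Z}^{E(\Gamma)}$ is free abelian with basis $e_{(v,w)}$, $(v,w)\in E^{or}(\Gamma)$, dual to the basis $v^*\cup w^*$ of $H^2(A_\Gamma)$. Let $l(v,w)\in\mathbb{Z}$ be the coefficient of $e_{(v,w)}$ in $\alpha$. The connection matrix $M_\alpha$ is the skew-symmetric integer matrix indexed by $V(\Gamma)$ with $(M_\alpha)_{v,w}=l(v,w)$ if $(v,w)\in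 E^{or}(\Gamma)$, $(M_\alpha)_{v,w}=-l(w,v)$ if $(w,v)\in E^{or}(\Gamma)$, and $0$ otherwise. It is independent of the chosen orientation. Conventions: the cap product is normalised by $\psi(\alpha\cap\varphi)=(\varphi\cup\psi)(\alpha)$ for $\varphi,\psi\in H^1$, and the matrix representation has as its row indexed by $v$ the coordinates of $\alpha\cap v^*$ in the basis $V(\Gamma)$, i.e. $\alpha\cap v^*=\sum_{w}(M_\alpha)_{v,w}\,w$. *)

(* Defs.v *)
From HB Require Import structures.
From mathcomp Require Import all_boot all_order all_algebra.
From mathcomp Require Import zify ring boolp classical_sets functions.
From mathcomp Require Import freeg.

Set Implicit Arguments.
Unset Strict Implicit.
Unset Printing Implicit Defensive.

Import GRing.Theory.

Local Open Scope ring_scope.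
Local Open Scope quotient_scope.

Section FreeAbelian.

Context {K : choiceType} {M : zmodType}.

Definition lin (f : K -> M) : {freeg K / int} -> M :=
  fglift (f : K -> zmodule M).

Fact lin_is_zmod_morphism f : zmod_morphism (lin f).
Proof. exact: (@lift_is_additive int K (zmodule M)). Qed.

HB.instance Definition _ f :=
  GRing.isZmodMorphism.Build {freeg K / int} M (lin f) (lin_is_zmod_morphism f).

Lemma linU f x : lin f << x >> = f x.
Proof. by rewrite /lin liftU scale1r. Qed.

Lemma additive_ext (g h : {additive {freeg K / int} -> M}) :
  (forall x, g << x >> = h << x >>) -> g =1 h.
Proof.
move=> gh c; rewrite -[c]freeg_sumE !raddf_sum; apply: eq_bigr => x _.
by rewrite -[coeff x c]intz -freegU_mulz !raddfMz gh.
Qed.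

Lemma linD (f g : K -> M) c : lin (f + g) c = lin f c + lin g c.
Proof.
apply: (@additive_ext (lin (f + g)) (lin f \+ lin g)) => x /=.
by rewrite !linU.
Qed.

Lemma lin0 c : lin (0 : K -> M) c = 0.
Proof. by apply: (@additive_ext (lin (0 : K -> M)) \0) => x /=; rewrite linU. Qed.

Lemma linN (f : K -> M) c : lin (- f) c = - lin f c.
Proof. by apply/eqP; rewrite -addr_eq0 -linD addNr lin0. Qed.

Lemma linB (f g : K -> M) c : lin (f - g) c = lin f c - lin g c.
Proof. by rewrite linD linN. Qed.

End FreeAbelian.

Section Bases.

Context {I J : finType} {U V : zmodType}.

Definition zbasis (b : I -> U) : Prop :=
  forall u, exists! c : {ffun I -> int}, u = \sum_i b i *~ c i.

Definition zcoord (b : I -> U) (bP : zbasis b) (u : U) : {ffun I -> int} :=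
  sval (cid (bP u)).

Lemma zcoordP (b : I -> U) (bP : zbasis b) u c :
  u = \sum_i b i *~ c i -> zcoord bP u =1 c.
Proof.
move=> uc i; rewrite /zcoord; case: cid => c' /= [_ cU].
rewrite (cU [ffun i => c i]) ?ffunE // uc.
by apply: eq_bigr => j _; rewrite ffunE.
Qed.

Definition zspan (b : I -> U) : {pred U} :=
  fun u => `[< exists c : I -> int, u = \sum_i b i *~ c i >].

Fact zspan_zmod_closed (b : I -> U) : zmod_closed (zspan b).
Proof.
split=> [|u u']; rewrite !unfold_in.
  by apply/asboolP; exists (fun=> 0); rewrite big1 // => i _; exact: mulr0z.
move=> /asboolP[c ->] /asboolP[c' ->]; apply/asboolP; exists (fun i => c i - c' i).
by rewrite -sumrB; apply: eq_bigr => i _; rewrite mulrzBr.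
Qed.

HB.instance Definition _ (b : I -> U) :=
  GRing.isZmodClosed.Build U (zspan b) (zspan_zmod_closed b).

Lemma mem_zspan (b : I -> U) i : b i \in zspan b.
Proof.
apply/asboolP; exists (fun j => (i == j)%:R); rewrite (bigD1 i) //= eqxx.
by rewrite big1 ?addr0 // => j; rewrite eq_sym => /negPf ->; rewrite mulr0z.
Qed.

Lemma zbasis_dual (b : I -> U) (p : I -> {additive U -> int}) :
  (forall i j, p i (b j) = (i == j)%:R) ->
  (forall u, u \in zspan b) -> zbasis b.
Proof.
move=> pb bS u; have /asboolP[c uc] := bS u; exists [ffun i => c i].
have pu i c' : u = \sum_i b i *~ c' i -> c' i = p i u.
  move=> ->; rewrite raddf_sum (bigD1 i) //= raddfMz /= pb eqxx.
  rewrite big1 ?addr0 ?intz // => j ji.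
  by rewrite raddfMz /= pb eq_sym (negPf ji) mul0rz.
split=> [|c' uc']; first by rewrite uc; apply: eq_bigr => i _; rewrite ffunE.
by apply/ffunP => i; rewrite ffunE (pu i c) // (pu i c').
Qed.

End Bases.

Section MatrixRepresentation.

(* Row convention: row i holds the coordinates of f (b i) in the basis b'. *)
Definition matrix_of (I J : finType) (U V : zmodType) (b : I -> U) (b' : J -> V)
    (bP : zbasis b) (b'P : zbasis b') (f : {additive U -> V}) : 'M[int]_(#|I|, #|J|) :=
  \matrix_(i, j) zcoord b'P (f (b (enum_val i))) (enum_val j).

End MatrixRepresentation.

Section GroupHomology.

Variable G : groupType.

Implicit Types n : nat.

Definition chain n := {freeg (n.-tuple G) / int}.

(* The i-th face of the bar symbol [g_1|...|g_n]: drop g_1 if i = 0, drop g_n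
   if i = n, and replace g_i, g_(i+1) by their product otherwise. *)
Fixpoint face_seq i (s : seq G) : seq G :=
  match s, i with
  | [::], _ => [::]
  | _ :: s', 0%N => s'
  | [:: _], _ => [::]
  | g :: (h :: s''), 1%N => (g * h)%g :: s''
  | g :: s', i'.+1 => g :: face_seq i' s'
  end.

Fact size_face_seq i s : size (face_seq i s) == (size s).-1.
Proof.
elim: s i => [|g [|h s] IHs] [|[|i]] //=.
by move: (IHs i.+1) => /= /eqP ->.
Qed.

Fact face_subproof n i (t : n.-tuple G) : size (face_seq i t) == n.-1.
Proof. by rewrite (eqP (size_face_seq i t)) size_tuple. Qed.

Definition face n i (t : n.-tuple G) : n.-1.-tuple G := Tuple (face_subproof i t).

(* With integral (trivial) coefficients, and with zero differential in
   degree 0. *)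
Definition bd n : chain n -> chain n.-1 :=
  lin (fun t => if n is 0 then 0 else \sum_(i < n.+1) (-1) ^+ i *: << face i t >>).

HB.instance Definition _ n := GRing.Additive.on (@bd n).

Definition is_cycle n : {pred chain n} := fun c => bd c == 0.

Fact is_cycle_zmod_closed n : zmod_closed (@is_cycle n).
Proof.
split=> [|c c']; rewrite !unfold_in ?raddf0 // => /eqP dc /eqP dc'.
by rewrite raddfB /= dc dc' subrr.
Qed.

HB.instance Definition _ n :=
  GRing.isZmodClosed.Build (chain n) (@is_cycle n) (@is_cycle_zmod_closed n).

Definition cycles n := {c : chain n | c \in @is_cycle n}.

HB.instance Definition _ n := SubChoice.on (cycles n).
HB.instance Definition _ n := [SubChoice_isSubZmodule of cycles n by <:].

Definition is_boundary n : {pred cycles n} :=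
  fun z => `[< exists b : chain n.+1, val z = bd b >].

Fact is_boundary_zmod_closed n : zmod_closed (@is_boundary n).
Proof.
split=> [|z z']; rewrite !unfold_in.
  by apply/asboolP; exists 0; rewrite !raddf0.
move=> /asboolP[b zb] /asboolP[b' zb']; apply/asboolP.
by exists (b - b'); rewrite !raddfB /= zb zb'.
Qed.

HB.instance Definition _ n :=
  GRing.isZmodClosed.Build (cycles n) (@is_boundary n) (@is_boundary_zmod_closed n).

Definition homology n : zmodType := Quotient.quot (@is_boundary n).

Definition cochain n := n.-tuple G -> int.

(* A cochain f is evaluated on chains by lin f, and its coboundary is
   lin f \o bd. *)
Definition is_cocycle n : {pred cochain n} :=
  fun f => `[< forall c : chain n.+1, lin f (bd c) = 0 >].

Fact is_cocycle_zmod_closed n : zmod_closed (@is_cocycle n).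
Proof.
split=> [|f f']; rewrite !unfold_in.
  by apply/asboolP => c; rewrite lin0.
by move=> /asboolP df /asboolP df'; apply/asboolP => c; rewrite linB df df' subrr.
Qed.

HB.instance Definition _ n :=
  GRing.isZmodClosed.Build (cochain n) (@is_cocycle n) (@is_cocycle_zmod_closed n).

Definition cocycles n := {f : cochain n | f \in @is_cocycle n}.

HB.instance Definition _ n := SubChoice.on (cocycles n).
HB.instance Definition _ n := [SubChoice_isSubZmodule of cocycles n by <:].

Definition is_coboundary n : {pred cocycles n} :=
  fun f => `[< exists h : cochain n.-1,
                 forall c : chain n, lin (val f) c = lin h (bd c) >].

Fact is_coboundary_zmod_closed n : zmod_closed (@is_coboundary n).
Proof.
split=> [|f f']; rewrite !unfold_in.
  by apply/asboolP; exists 0 => c; rewrite !lin0.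
move=> /asboolP[h fh] /asboolP[h' fh']; apply/asboolP.
by exists (h - h') => c; rewrite raddfB !linB fh fh'.
Qed.

HB.instance Definition _ n :=
  GRing.isZmodClosed.Build (cocycles n) (@is_coboundary n) (@is_coboundary_zmod_closed n).

Definition cohomology n : zmodType := Quotient.quot (@is_coboundary n).

Definition kronecker n (x : cohomology n) (a : homology n) : int :=
  lin (val (repr x)) (val (repr a)).

Lemma kroneckerE n (f : cocycles n) (z : cycles n) :
  kronecker (\pi_(cohomology n) f) (\pi_(homology n) z) = lin (val f) (val z).
Proof.
rewrite /kronecker; set x := \pi f; set a := \pi z.
have /asboolP[h fh] : repr x - f \in @is_coboundary n.
  by rewrite Quotient.idealrBE reprK.
have /asboolP[b zb] : repr a - z \in @is_boundary n.
  by rewrite Quotient.idealrBE reprK.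
have /asboolP df := valP f; have /eqP dz := valP (repr a).
have -> : val (repr x) = val (repr x - f) + val f by rewrite raddfB subrK.
rewrite linD fh dz raddf0 add0r.
have -> : val (repr a) = bd b + val z by rewrite -zb raddfB subrK.
by rewrite raddfD /= df add0r.
Qed.

(* Products of classes of degree one, on bar chains and cochains:
   (f \cup h)[g_1|g_2] = f[g_1] h[g_2]  and  [g_1|g_2] \cap f = f[g_1] [g_2]. *)
Definition cochain_cup (f h : cochain 1) : cochain 2 :=
  fun t => f [tuple tnth t ord0] * h [tuple tnth t ord_max].

Definition chain_cap (c : chain 2) (f : cochain 1) : chain 1 :=
  lin (fun t : 2.-tuple G =>
         << [tuple tnth t ord_max] >> *~ f [tuple tnth t ord0]) c.

Lemma bd1 (c : chain 1) : bd c = 0.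
Proof.
apply: (@additive_ext _ _ (@bd 1) \0) => t /=.
rewrite /bd linU big_ord_recl big_ord1 /= expr0 scale1r expr1 scaleN1r.
by rewrite [face 0 t]tuple0 [face _ t]tuple0 subrr.
Qed.

Lemma bd2 g h : @bd 2 << [tuple g; h] >> =
  << [tuple h] >> - << [tuple (g * h)%g] >> + << [tuple g] >>.
Proof.
rewrite /bd linU !big_ord_recl big_ord0 /= addr0.
rewrite expr0 scale1r expr1 scaleN1r sqrrN expr1n scale1r addrA.
by congr (<< _ >> - << _ >> + << _ >>); apply: val_inj.
Qed.

Lemma bd3 g h k : @bd 3 << [tuple g; h; k] >> =
  << [tuple h; k] >> - << [tuple (g * h)%g; k] >>
    + << [tuple g; (h * k)%g] >> - << [tuple g; h] >>.
Proof.
rewrite /bd linU !big_ord_recl big_ord0 /= addr0.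
rewrite expr0 scale1r expr1 scaleN1r sqrrN expr1n scale1r -signr_odd expr1.
rewrite scaleN1r !addrA.
by congr (<< _ >> - << _ >> + << _ >> - << _ >>); apply: val_inj.
Qed.

Lemma cocycle1P (f : cochain 1) :
  f \in @is_cocycle 1 <->
  forall g h, f [tuple (g * h)%g] = f [tuple g] + f [tuple h].
Proof.
split=> [/asboolP df g h | fM].
  have := df << [tuple g; h] >>; rewrite bd2 !raddfD raddfN /= !linU.
  by move/eqP; rewrite addrAC subr_eq0 addrC => /eqP ->.
apply/asboolP; apply: (@additive_ext _ _ (lin f \o @bd 2) \0) => t /=.
case/tupleP: t => g t; case/tupleP: t => h t; rewrite (tuple0 t).
by rewrite bd2 !raddfD raddfN /= !linU fM; ring.
Qed.

Fact cup_cocycle (f h : cocycles 1) :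
  cochain_cup (val f) (val h) \in @is_cocycle 2.
Proof.
have fM := (cocycle1P _).1 (valP f); have hM := (cocycle1P _).1 (valP h).
apply/asboolP; apply: (@additive_ext _ _ (lin _ \o @bd 3) \0) => t /=.
case/tupleP: t => g1 t; case/tupleP: t => g2 t; case/tupleP: t => g3 t.
rewrite (tuple0 t) bd3 !raddfD !raddfN /= !linU /cochain_cup.
rewrite !(tnth_nth 1%g) /= fM hM. ring.
Qed.

Definition cup (x y : cohomology 1) : cohomology 2 :=
  \pi_(cohomology 2)
    (Sub (cochain_cup (val (repr x)) (val (repr y)))
         (cup_cocycle (repr x) (repr y)) : cocycles 2).

(* Every 1-chain is a cycle. *)
Definition class1 (c : chain 1) : homology 1 :=
  \pi_(homology 1) (Sub c (introT eqP (bd1 c)) : cycles 1).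

Fact class1_is_zmod_morphism : zmod_morphism class1.
Proof. by move=> c c'; rewrite -raddfB; congr (\pi _); apply: val_inj. Qed.

HB.instance Definition _ := GRing.isZmodMorphism.Build (chain 1) (homology 1)
  class1 class1_is_zmod_morphism.

Lemma class1_bd (b : chain 2) : class1 (bd b) = 0.
Proof.
rewrite /class1 -[RHS](raddf0 (\pi_(homology 1))).
by apply/eqP; rewrite -Quotient.idealrBE subr0; apply/asboolP; exists b.
Qed.

Lemma homology1_class1 (a : homology 1) : a = class1 (val (repr a)).
Proof. by rewrite -[LHS]reprK; congr (\pi _); apply: val_inj. Qed.

Definition cap (a : homology 2) (x : cohomology 1) : homology 1 :=
  class1 (chain_cap (val (repr a)) (val (repr x))).

Lemma repr_cohomology1 (f : cocycles 1) : repr (\pi_(cohomology 1) f) = f.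
Proof.
set x := \pi f.
have /asboolP[h fh] : repr x - f \in @is_coboundary 1.
  by rewrite Quotient.idealrBE reprK.
apply/eqP; rewrite -subr_eq0; apply/eqP/val_inj/funext => t /=.
by rewrite -[LHS]linU fh bd1 raddf0.
Qed.

Lemma cupE (f h : cocycles 1) :
  cup (\pi_(cohomology 1) f) (\pi_(cohomology 1) h) =
  \pi_(cohomology 2)
    (Sub (cochain_cup (val f) (val h)) (cup_cocycle f h) : cocycles 2).
Proof. by rewrite /cup; congr (\pi _); apply: val_inj => /=; rewrite !repr_cohomology1. Qed.

Lemma capE (z : cycles 2) (f : cocycles 1) :
  cap (\pi_(homology 2) z) (\pi_(cohomology 1) f) =
  class1 (chain_cap (val z) (val f)).
Proof.
rewrite /cap repr_cohomology1; set a := \pi z.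
have /asboolP[b zb] : repr a - z \in @is_boundary 2.
  by rewrite Quotient.idealrBE reprK.
have fM := (cocycle1P _).1 (valP f).
apply/eqP; rewrite -subr_eq0 -raddfB -raddfB -[sval _ - _]/(val (repr a - z)) zb.
rewrite -(class1_bd (- lin (fun t : 3.-tuple G =>
  << [tuple tnth t (fintype.lift ord0 ord0); tnth t ord_max] >>
    *~ val f [tuple tnth t ord0]) b)).
apply/eqP; congr class1.
rewrite raddfN.
apply: (@additive_ext _ _ (lin _ \o @bd 3) (\- (@bd 2 \o lin _))) => t /=.
case/tupleP: t => g1 t; case/tupleP: t => g2 t; case/tupleP: t => g3 t.
rewrite (tuple0 t) bd3 !raddfD !raddfN /= !linU.
rewrite !(tnth_nth 1%g) /= (raddfMz (@bd 2)) /= bd2 fM.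
rewrite !(mulrzDr, mulrzDl, mulNrz) !opprD !opprK !addrA.
by congr (_ + _ - _); rewrite addrAC subrr add0r.
Qed.

Fact kronecker_is_zmod_morphism n (x : cohomology n) : zmod_morphism (kronecker x).
Proof.
move=> a a'; rewrite -[x]reprK -[a]reprK -[a']reprK -raddfB !kroneckerE.
by rewrite (raddfB (val : cycles n -> chain n)) raddfB.
Qed.

HB.instance Definition _ n (x : cohomology n) :=
  GRing.isZmodMorphism.Build (homology n) int (kronecker x)
    (kronecker_is_zmod_morphism x).

Definition kronecker_r n (a : homology n) (x : cohomology n) := kronecker x a.

Fact kronecker_r_is_zmod_morphism n (a : homology n) :
  zmod_morphism (kronecker_r a).
Proof.
move=> x x'; rewrite /kronecker_r.
rewrite -[x]reprK -[a]reprK -[x']reprK -raddfB !kroneckerE.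
by rewrite raddfB linB.
Qed.

HB.instance Definition _ n (a : homology n) :=
  GRing.isZmodMorphism.Build (cohomology n) int (kronecker_r a)
    (kronecker_r_is_zmod_morphism a).

Fact cap_is_zmod_morphism a : zmod_morphism (cap a).
Proof.
move=> x y; rewrite -[a]reprK -[x]reprK -[y]reprK -raddfB !capE -raddfB.
congr class1; apply: (@additive_ext _ _ (lin _) (lin _ \- lin _)) => t /=.
by rewrite !linU mulrzBr.
Qed.

HB.instance Definition _ a :=
  GRing.isZmodMorphism.Build (cohomology 1) (homology 1) (cap a)
    (cap_is_zmod_morphism a).

Lemma kronecker_cap (a : homology 2) (x y : cohomology 1) :
  kronecker y (cap a x) = kronecker (cup x y) a.
Proof.
rewrite -[a]reprK -[x]reprK -[y]reprK capE cupE !kroneckerE /=.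
apply: (@additive_ext _ _ (lin _ \o lin _) (lin _)) => t /=.
by rewrite !linU (raddfMz (lin _)) /= linU /cochain_cup mulrzz mulrC.
Qed.

End GroupHomology.

Arguments homology G n : clear implicits.
Arguments cohomology G n : clear implicits.

Record sgraph := SGraph {
  vertex :> finType;
  adj : rel vertex;
  adj_sym : symmetric adj;
  adj_irr : irreflexive adj }.

Section RightAngledArtinGroup.

Variable Gamma : sgraph.

(* The letter (v, true) stands for the generator v, (v, false) for its
   inverse. *)
Definition word := seq (Gamma * bool).

Inductive raag_rel : word -> word -> Prop :=
| raag_refl w : raag_rel w w
| raag_sym w w' : raag_rel w w' -> raag_rel w' w
| raag_trans w w' w'' : raag_rel w w' -> raag_rel w' w'' -> raag_rel w w''
| raag_ctx u w w' x : raag_rel w w' -> raag_rel (u ++ w ++ x) (u ++ w' ++ x)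
| raag_cancel v b : raag_rel [:: (v, b); (v, ~~ b)] [::]
| raag_comm v w : adj v w ->
    raag_rel [:: (v, true); (w, true)] [:: (w, true); (v, true)].

Definition raag_relb : rel word := fun w w' => `[< raag_rel w w' >].

Fact raag_relb_equiv : equiv_class_of raag_relb.
Proof.
split=> [w|w w'|w' w w'']; first exact/asboolP/raag_refl.
  by apply/asboolP/asboolP => /raag_sym.
by move=> /asboolP ww' /asboolP w'w''; apply/asboolP/(raag_trans ww').
Qed.

Canonical raag_equiv := EquivRelPack raag_relb_equiv.
Canonical raag_encModRel := defaultEncModRel raag_relb.

Definition raag := {eq_quot raag_relb}.

HB.instance Definition _ := EqQuotient.on raag.
HB.instance Definition _ := Choice.on raag.

Definition raag_of_word (w : word) : raag := \pi_raag w.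

Lemma raag_eqP w w' : raag_of_word w = raag_of_word w' <-> raag_rel w w'.
Proof.
by split=> [/eqP|ww']; [rewrite eqmodE => /asboolP | apply/eqP; rewrite eqmodE; apply/asboolP].
Qed.

Definition inv_word (w : word) : word := rev [seq (l.1, ~~ l.2) | l <- w].

Definition raag_mul (g h : raag) : raag := raag_of_word (repr g ++ repr h).
Definition raag_inv (g : raag) : raag := raag_of_word (inv_word (repr g)).

Lemma raag_repr w : raag_rel (repr (raag_of_word w)) w.
Proof. by apply/raag_eqP; rewrite /raag_of_word reprK. Qed.

Lemma raag_relM w1 w1' w2 w2' :
  raag_rel w1 w1' -> raag_rel w2 w2' -> raag_rel (w1 ++ w2) (w1' ++ w2').
Proof.
move=> r1 r2; apply: (raag_trans (w' := w1' ++ w2)).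
  exact: (raag_ctx [::] w2 r1).
by have := raag_ctx w1' [::] r2; rewrite !cats0.
Qed.

Lemma raag_mulE w w' :
  raag_mul (raag_of_word w) (raag_of_word w') = raag_of_word (w ++ w').
Proof. by apply/raag_eqP/raag_relM; apply: raag_repr. Qed.

Lemma raag_relVw w : raag_rel (inv_word w ++ w) [::].
Proof.
elim: w => [|[v b] w IHw]; first exact: raag_refl.
rewrite /inv_word /= rev_cons cat_rcons; apply: raag_trans IHw.
have := raag_ctx (inv_word w) w (raag_cancel v (~~ b)).
by rewrite negbK.
Qed.

Lemma inv_wordK : involutive inv_word.
Proof.
move=> w; rewrite /inv_word map_rev revK -map_comp map_id_in // => -[v b] _ /=.
by rewrite negbK.
Qed.

Lemma raag_reprK g : raag_of_word (repr g) = g.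
Proof. exact: reprK. Qed.

Lemma raag_mulA : associative raag_mul.
Proof.
by move=> g h k; rewrite -[g]raag_reprK -[h]raag_reprK -[k]raag_reprK !raag_mulE catA.
Qed.

Lemma raag_mul1g : left_id (raag_of_word [::]) raag_mul.
Proof. by move=> g; rewrite -[g]raag_reprK raag_mulE. Qed.

Lemma raag_mulg1 : right_id (raag_of_word [::]) raag_mul.
Proof. by move=> g; rewrite -[g]raag_reprK raag_mulE cats0. Qed.

Lemma raag_mulVg : left_inverse (raag_of_word [::]) raag_inv raag_mul.
Proof.
by move=> g; rewrite -{2}[g]raag_reprK raag_mulE; apply/raag_eqP/raag_relVw.
Qed.

Lemma raag_mulgV : right_inverse (raag_of_word [::]) raag_inv raag_mul.
Proof.
move=> g; rewrite -{1}[g]raag_reprK raag_mulE; apply/raag_eqP.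
by have := raag_relVw (inv_word (repr g)); rewrite inv_wordK.
Qed.

HB.instance Definition _ := isGroup.Build raag
  raag_mulA raag_mul1g raag_mulg1 raag_mulVg raag_mulgV.

Lemma raag_of_word_cat w w' :
  raag_of_word (w ++ w') = (raag_of_word w * raag_of_word w')%g.
Proof. by rewrite [RHS]raag_mulE. Qed.

Definition gen (v : Gamma) : raag := raag_of_word [:: (v, true)].

Lemma gen_comm v w : adj v w -> (gen v * gen w = gen w * gen v)%g.
Proof. by move=> vw; rewrite ![LHS]raag_mulE ![RHS]raag_mulE; apply/raag_eqP/raag_comm. Qed.

End RightAngledArtinGroup.

Lemma raag_ind (Gamma : sgraph) (P : raag Gamma -> Prop) :
  P 1%g -> (forall v g, P g -> P (gen v * g)%g) ->
  (forall v g, P g -> P ((gen v)^-1 * g)%g) -> forall g, P g.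
Proof.
move=> P1 Pg PV g; rewrite -[g]raag_reprK; elim: (repr g) => [|[v b] w IHw] //.
have -> : raag_of_word ((v, b) :: w) =
    ((if b then gen v else (gen v)^-1) * raag_of_word w)%g.
  rewrite -cat1s raag_of_word_cat; congr (_ * _)%g; case: b => //.
  apply: (@mulIg _ (gen v)); rewrite mulVg -raag_of_word_cat.
  exact/raag_eqP/(raag_cancel v false).
by case: b; [apply: Pg | apply: PV].
Qed.

Section CentralExtension.

Variables (Gamma : sgraph) (Q : zmodType) (c : raag Gamma -> raag Gamma -> Q).

Hypothesis cA : forall g h k, c h k + c g (h * k)%g = c (g * h)%g k + c g h.
Hypothesis cC : forall v w, adj v w -> c (gen v) (gen w) = c (gen w) (gen v).

Let c1g g : c 1%g g = c 1%g 1%g.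
Proof. by have := cA 1%g 1%g g; rewrite !mul1g => /addrI. Qed.

Let cg1 g : c g 1%g = c 1%g 1%g.
Proof. by have := cA g 1%g 1%g; rewrite !mulg1 => /addIr. Qed.

Let cgV g : c g^-1%g g = c g g^-1%g.
Proof. by have := cA g g^-1%g g; rewrite mulgV mulVg c1g cg1 addrC => /addrI. Qed.

Let letter (l : Gamma * bool) : raag Gamma := raag_of_word [:: l].

Let letterF v : letter (v, false) = (gen v)^-1%g.
Proof.
apply: (@mulIg _ (gen v)); rewrite mulVg -raag_of_word_cat.
exact/raag_eqP/(raag_cancel v false).
Qed.

Fixpoint splitting_word (w : word Gamma) : Q :=
  if w is l :: w' then
    (if l.2 then 0 else - c 1%g 1%g - c (gen l.1) (gen l.1)^-1%g)
      + c (letter l) (raag_of_word w') + splitting_word w'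
  else - c 1%g 1%g.

Lemma splitting_word_cat w w' :
  splitting_word (w ++ w') =
  splitting_word w + splitting_word w' + c (raag_of_word w) (raag_of_word w').
Proof.
elim: w => [|l w IHw] /=; first by rewrite c1g addrAC addNr add0r.
rewrite IHw raag_of_word_cat -(cat1s l w) raag_of_word_cat.
have E := cA (letter l) (raag_of_word w) (raag_of_word w').
by rewrite [LHS](AC (2*3) ((1*3*4)*(5*2))) [RHS](AC 5 ((1*3*4)*(5*2))) /= E.
Qed.

Lemma raag_rel_splitting w w' : raag_rel w w' -> splitting_word w = splitting_word w'.
Proof.
elim=> {w w'} //.
- by move=> w w' w'' _ -> _ ->.
- move=> u w w' x /raag_eqP ww' E; rewrite !splitting_word_cat E.
  by rewrite !raag_of_word_cat ww'.
- move=> v b /=; rewrite -[raag_of_word [::]]/(1%g : raag Gamma) cg1.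
  rewrite -[raag_of_word [:: (v, ~~b)]]/(letter (v, ~~b)).
  case: b; rewrite /= letterF -?[letter (v, true)]/(gen v) ?cgV.
    by rewrite add0r addrK addrC subrK.
  by rewrite subrK add0r subrr addr0.
- move=> v w vw /=; rewrite -[raag_of_word [::]]/(1%g : raag Gamma) !cg1.
  by rewrite !add0r -/(gen v) -/(gen w) cC.
Qed.

Definition splitting (g : raag Gamma) : Q := splitting_word (repr g).

Lemma splittingM g h : splitting (g * h)%g = splitting g + splitting h + c g h.
Proof.
by rewrite /splitting (raag_rel_splitting (raag_repr _)) splitting_word_cat !raag_reprK.
Qed.

End CentralExtension.

Section Classes.

Variable Gamma : sgraph.

Local Notation A := (raag Gamma).

(* The generators of A as classes in H_1(A). *)
Definition gen_class (v : Gamma) : homology A 1 := class1 << [tuple gen v] >>.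

Definition exponent (v : Gamma) (w : word Gamma) : int :=
  \sum_(l <- w | l.1 == v) (-1) ^+ ~~ l.2.

Lemma exponent_cat v w w' : exponent v (w ++ w') = exponent v w + exponent v w'.
Proof. exact: big_cat. Qed.

Lemma raag_rel_exponent v w w' : raag_rel w w' -> exponent v w = exponent v w'.
Proof.
elim=> {w w'} //.
- by move=> w w' w'' _ -> _ ->.
- by move=> u w w' x _; rewrite !exponent_cat => ->.
- move=> x b; rewrite /exponent !big_cons big_nil /=.
  by case: eqP => // _; case: b.
- move=> x y _; rewrite -[[:: _; (y, _)]]cat1s -[[:: _; (x, _)]]cat1s.
  by rewrite !exponent_cat addrC.
Qed.

Definition dual_cochain (v : Gamma) : cochain A 1 :=
  fun t => exponent v (repr (tnth t ord0)).

Fact dual_cocycle v : dual_cochain v \in @is_cocycle A 1.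
Proof.
apply/cocycle1P => g h; rewrite /dual_cochain !(tnth_nth 1%g) /= -exponent_cat.
exact/raag_rel_exponent/raag_repr.
Qed.

Definition dual_class (v : Gamma) : cohomology A 1 :=
  \pi_(cohomology A 1) (Sub (dual_cochain v) (dual_cocycle v) : cocycles A 1).

Lemma dual_cochain_gen v w : dual_cochain v [tuple gen w] = (v == w)%:R.
Proof.
rewrite /dual_cochain (tnth_nth 1%g) /= (raag_rel_exponent _ (raag_repr _)).
by rewrite /exponent big_cons big_nil /= eq_sym; case: eqP.
Qed.

Lemma kronecker_dual_gen v w : kronecker (dual_class v) (gen_class w) = (v == w)%:R.
Proof. by rewrite kroneckerE /= linU dual_cochain_gen. Qed.

Definition torus_chain (v w : Gamma) : chain A 2 :=
  << [tuple gen v; gen w] >> - << [tuple gen w; gen v] >>.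

Fact torus_cycle v w : adj v w -> torus_chain v w \in @is_cycle A 2.
Proof.
move=> vw; rewrite unfold_in raddfB /= !bd2 (gen_comm vw) subr_eq0 addrAC; apply/eqP.
by rewrite [RHS]addrAC; congr (_ - _); rewrite addrC.
Qed.

Definition torus_class v w (vw : adj v w) : homology A 2 :=
  \pi_(homology A 2) (Sub (torus_chain v w) (torus_cycle vw) : cycles A 2).

Lemma kronecker_cup_torus (x y v w : Gamma) (vw : adj v w) :
  kronecker (cup (dual_class x) (dual_class y)) (torus_class vw) =
  (x == v)%:R * (y == w)%:R - (x == w)%:R * (y == v)%:R.
Proof.
rewrite cupE kroneckerE /= raddfB /= !linU /cochain_cup !(tnth_nth 1%g) /=.
by rewrite !dual_cochain_gen.
Qed.

Lemma chain1_hom (U : zmodType) (F : {additive chain A 1 -> U}) :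
  (forall g h, F << [tuple (g * h)%g] >> = F << [tuple g] >> + F << [tuple h] >>) ->
  forall S : zmodClosed U, (forall v, F << [tuple gen v] >> \in S) ->
  forall c, F c \in S.
Proof.
move=> FM S FS; have F1 : F << [tuple 1%g] >> = 0.
  by have := FM 1%g 1%g; rewrite mulg1 -[LHS]addr0 => /addrI.
have FV g : F << [tuple g^-1%g] >> = - F << [tuple g] >>.
  by apply/eqP; rewrite -addr_eq0 -FM mulVg F1.
have Fg g : F << [tuple g] >> \in S.
  elim/raag_ind: g => [|v g IHg|v g IHg]; first by rewrite F1 rpred0.
    by rewrite FM rpredD.
  by rewrite FM FV rpredD ?rpredN.
move=> c; rewrite -[c]freeg_sumE raddf_sum rpred_sum // => t _.
rewrite -[coeff t c]intz -freegU_mulz raddfMz rpredMz //.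
by case/tupleP: t => g t; rewrite (tuple0 t).
Qed.

Lemma class1M g h : class1 << [tuple (g * h)%g : A] >> =
  class1 << [tuple g] >> + class1 << [tuple h] >>.
Proof.
have := class1_bd (<< [tuple g; h] >> : chain A 2).
rewrite bd2 raddfD raddfB /= => /eqP; rewrite addrAC subr_eq0 => /eqP <-.
exact: addrC.
Qed.

Lemma gen_class_basis : zbasis gen_class.
Proof.
apply: (zbasis_dual (p := fun v => kronecker (dual_class v))).
  exact: kronecker_dual_gen.
move=> a; rewrite [a]homology1_class1.
by apply: (chain1_hom class1M (S := zspan gen_class)) => v; apply: mem_zspan.
Qed.

Lemma dual_class_basis : zbasis dual_class.
Proof.
apply: (zbasis_dual (p := fun v => kronecker_r (gen_class v))) => [v w|x].
  by rewrite /= /kronecker_r kronecker_dual_gen eq_sym.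
apply/asboolP; exists (fun v => kronecker_r (gen_class v) x); apply/eqP.
rewrite -subr_eq0; set y := _ - _.
have y0 v : kronecker y (gen_class v) = 0.
  rewrite -[LHS]/(kronecker_r (gen_class v) y) raddfB raddf_sum (bigD1 v) //=.
  rewrite raddfMz /= {2}/kronecker_r kronecker_dual_gen eqxx intz big1 ?addr0 ?subrr //.
  move=> w wv; rewrite raddfMz /= /kronecker_r kronecker_dual_gen.
  by rewrite (negPf wv) mul0rz.
move: y0; rewrite -[y]reprK; set f := repr y => f0.
suff -> : f = 0 by rewrite raddf0.
have fM := (cocycle1P _).1 (valP f).
have lfM g h : lin (val f) << [tuple (g * h)%g] >> =
    lin (val f) << [tuple g] >> + lin (val f) << [tuple h] >> by rewrite !linU.
have lf0 v : lin (val f) << [tuple gen v] >> \in zspan (fun _ : Gamma => 0 : int).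
  by have := f0 v; rewrite kroneckerE /= => ->; rewrite rpred0.
apply/val_inj/funext => t /=; rewrite -[LHS]linU.
have /asboolP[c ->] := chain1_hom lfM lf0 << t >>.
by rewrite big1 // => v _; rewrite mul0rz.
Qed.

End Classes.

Record orientation (Gamma : sgraph) := Orientation {
  dart : rel Gamma;
  dart_adj : forall v w, dart v w -> adj v w;
  dart_choice : forall v w, adj v w -> dart v w (+) dart w v }.

Section ConnectionMatrix.

Variables (Gamma : sgraph) (o : orientation Gamma).

Local Notation A := (raag Gamma).

(* E^or. *)
Definition darts := {p : Gamma * Gamma | dart o p.1 p.2}.

Definition edge_class (p : darts) : homology A 2 := torus_class (dart_adj (valP p)).

Let edge_chain (p : darts) : chain A 2 := torus_chain (val p).1 (val p).2.

Definition null2 : {pred chain A 2} :=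
  fun z => `[< exists b : chain A 3, z - bd b \in zspan edge_chain >].

Fact null2_zmod_closed : zmod_closed null2.
Proof.
split=> [|z z']; rewrite !unfold_in.
  by apply/asboolP; exists 0; rewrite raddf0 subr0 rpred0.
move=> /asboolP[b zb] /asboolP[b' zb']; apply/asboolP; exists (b - b').
by rewrite raddfB opprD addrACA -opprD rpredB.
Qed.

HB.instance Definition _ :=
  GRing.isZmodClosed.Build (chain A 2) null2 null2_zmod_closed.

Let Q : zmodType := Quotient.quot null2.

Let c (g h : A) : Q := \pi_Q << [tuple g; h] >>.

Let cA g h k : c h k + c g (h * k)%g = c (g * h)%g k + c g h.
Proof.
rewrite -!raddfD; apply/eqP; rewrite -Quotient.idealrBE; apply/asboolP.
exists << [tuple g; h; k] >>.
by rewrite bd3 opprD addrA (addrAC << [tuple h; k] >>) subrr rpred0.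
Qed.

Let cC v w : adj v w -> c (gen v) (gen w) = c (gen w) (gen v).
Proof.
move=> vw; apply/eqP; rewrite -Quotient.idealrBE; apply/asboolP; exists 0.
rewrite raddf0 subr0; have := dart_choice o vw.
case vw' : (dart o v w); first by move=> _; apply: (mem_zspan edge_chain (Sub (v, w) vw')).
move=> /= wv'; rewrite -opprB rpredN.
exact: (mem_zspan edge_chain (Sub (w, v) wv')).
Qed.

Lemma cycle_null2 (z : cycles A 2) : val z \in null2.
Proof.
pose phi (t : 1.-tuple A) : Q := splitting c (tnth t ord0).
have cE : \pi_Q =1 (\- (lin phi \o @bd A 2)).
  apply: additive_ext => t /=.
  case/tupleP: t => g t; case/tupleP: t => h t; rewrite (tuple0 t).
  rewrite bd2 raddfD raddfB /= !linU /phi !(tnth_nth 1%g) /=.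
  by rewrite (splittingM cA cC) opprD opprB (addrAC (splitting c g + _)) addrK addrAC subrr add0r.
have /eqP dz := valP z.
have := cE (val z); rewrite /= dz raddf0 oppr0 -(raddf0 \pi_Q) => /eqP.
by rewrite -Quotient.idealrBE subr0.
Qed.

Lemma edge_class_basis : zbasis edge_class.
Proof.
apply: (zbasis_dual (p := fun p =>
   kronecker (cup (dual_class (val p).1) (dual_class (val p).2)))).
  move=> [[x y] /= xy] [[v w] /= vw].
  rewrite /edge_class kronecker_cup_torus -val_eqE /= xpair_eqE -!natrM !mulnb.
  case: (x =P w) xy => [->|_]; case: (y =P v) => [->|_] wv; rewrite ?subr0 //.
  by have := dart_choice o (dart_adj vw); rewrite vw wv.
move=> a; have /asboolP[b /asboolP[l zbl]] := cycle_null2 (repr a).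
apply/asboolP; exists l; rewrite -[a]reprK.
pose u : cycles A 2 := \sum_p
  (Sub (edge_chain p) (torus_cycle (dart_adj (valP p))) : cycles A 2) *~ l p.
transitivity (\pi_(homology A 2) u); last first.
  by rewrite raddf_sum; apply: eq_bigr => p _; rewrite raddfMz.
apply/eqP; rewrite -Quotient.idealrBE; apply/asboolP; exists b.
rewrite raddfB raddf_sum /= -[bd b](subKr (val (repr a))) zbl; congr (_ - _).
by apply: eq_bigr => p _; exact: (raddfMz (val : cycles A 2 -> chain A 2)).
Qed.

Definition connection_matrix (a : homology A 2) : 'M[int]_#|Gamma| :=
  let l := zcoord edge_class_basis a in
  \matrix_(i, j)
    let v := enum_val i in let w := enum_val j in
    if insub (v, w) is Some p then l p
    else if insub (w, v) is Some p then - l p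
    else 0.

End ConnectionMatrix.

Arguments dual_class_basis Gamma : clear implicits.
Arguments gen_class_basis Gamma : clear implicits.

(* Main.v *)
Require Import Defs.
From mathcomp Require Import all_boot all_algebra.
From mathcomp Require Import boolp.

Set Implicit Arguments.
Unset Strict Implicit.
Unset Printing Implicit Defensive.

Import GRing.Theory.

Local Open Scope ring_scope.

(** Write [v'] for the class in H^1 dual to the generator [v]. The entry at
[(v, w)] of the matrix of the cap product with [alpha] is the [w]-coordinate of
[alpha \cap v'] and, by duality of the two bases under the Kronecker pairing, it
equals the value of [w'] on [alpha \cap v'] ([zcoord_dual]). The adjunction
between cup and cap products turns it into the value of [v' \cup w'] on [alpha].

It remains to evaluate [v' \cup w'] on [alpha = \sum_p l_p e_p]. On the torus
class [e_(x, y)] it takes the value [1] if [(v, w) = (x, y)], [-1] if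
[(w, v) = (x, y)], and [0] otherwise. At most one of the two pairs [(v, w)] and
[(w, v)] is a chosen edge, so the sum reduces to [l_(v, w)], to [- l_(w, v)] or
to [0] ([kronecker_cup_edges]), which is how the connection matrix is defined. *)

Lemma zcoord_sum (I : finType) (U : zmodType) (b : I -> U) (bP : zbasis b) u :
  u = \sum_i b i *~ zcoord bP u i.
Proof. by rewrite /zcoord; case: cid => c []. Qed.

(** A dual family of functionals picks out the coefficients of any expansion in
the basis, which makes the coordinates computable although [zcoord] is defined
by choice. *)
Lemma zcoord_dual (I : finType) (U : zmodType) (b : I -> U) (bP : zbasis b)
    (p : I -> {additive U -> int}) :
  (forall i j, p i (b j) = (i == j)%:R) -> forall u i, zcoord bP u i = p i u.
Proof.
move=> pb u i; rewrite [in RHS](zcoord_sum bP u) raddf_sum (bigD1 i) //=.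
rewrite raddfMz /= pb eqxx intz big1 ?addr0 // => j ji.
by rewrite raddfMz /= pb eq_sym (negPf ji) mul0rz.
Qed.

Section Edges.

Variables (Gamma : sgraph) (o : orientation Gamma).

Lemma dart_asym v w : dart o v w -> dart o w v = false.
Proof. by move=> vw; have := dart_choice o (dart_adj vw); rewrite vw => /negPf. Qed.

Lemma sum_darts (F : darts o -> int) v w :
  \sum_p F p * ((v == (val p).1)%:R * (w == (val p).2)%:R) =
  if insub (v, w) is Some p then F p else 0.
Proof.
have E (p : darts o) :
    (v == (val p).1)%:R * (w == (val p).2)%:R = ((v, w) == val p)%:R :> int.
  by rewrite -natrM mulnb; case: (val p).
case: insubP => [q _ qvw | nvw]; last first.
  apply: big1 => p _; rewrite E; case: eqP => [vwp|_]; last by rewrite mulr0.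
  by rewrite vwp (valP p) in nvw.
rewrite (bigD1 q) //= E -qvw eqxx mulr1 big1 ?addr0 // => p pq.
by rewrite E -qvw val_eqE eq_sym (negPf pq) mulr0.
Qed.

(** Expanding [a] in the basis of torus classes leaves one contribution from
[(v, w)] and one, with the opposite sign, from [(w, v)]; asymmetry of the
orientation keeps them from occurring together. *)
Lemma kronecker_cup_edges (a : homology (raag Gamma) 2) v w :
  let l := zcoord (edge_class_basis o) a in
  kronecker (cup (dual_class v) (dual_class w)) a =
  if insub (v, w) is Some p then l p
  else if insub (w, v) is Some p then - l p else 0.
Proof.
move=> l; rewrite [in LHS](zcoord_sum (edge_class_basis o) a) raddf_sum /=.
under eq_bigr => p _.
  rewrite raddfMz /= /edge_class kronecker_cup_torus -mulrzl intz mulrBr.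
  rewrite [X in _ - _ * X]mulrC; over.
rewrite sumrB !sum_darts -/l; case: insubP => [p /= vw _ | _].
  by rewrite insubF ?subr0 //= dart_asym.
by rewrite sub0r; case: insub => [p|]; rewrite ?oppr0.
Qed.

End Edges.

Theorem proposition3p2 (Gamma : sgraph) (o : orientation Gamma)
    (alpha : homology (raag Gamma) 2) :
  connection_matrix o alpha =
  matrix_of (dual_class_basis Gamma) (gen_class_basis Gamma) (cap alpha).
Proof.
apply/matrixP => i j; rewrite !mxE /=.
rewrite (zcoord_dual _ (p := fun v => kronecker (dual_class v))); last first.
  exact: kronecker_dual_gen.
by rewrite /= kronecker_cap (kronecker_cup_edges o).
Qed.
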